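(* Let $S$ be a finite group of planar rotations and mirror reflections as specified in the context, and let $\Phi_{eq}$ be an equivariant vision transformer for $S$ that includes $L$ equivariant self-attention layers (defined in the context), with arbitrary values of its learnable parameters. Let $\mathbf{x}$ be an image of size $H\times W\times c_0$. Then for every $\tilde g\in S$, $$\Phi_{eq}[\pi_{\tilde g}](\mathbf{x})=\pi_{\tilde g}[\Phi_{eq}](\mathbf{x}),$$ where $[\cdot]$ denotes composition of functions, i.e. $\Phi_{eq}(\pi_{\tilde g}(\mathbf{x}))=\pi_{\tilde g}(\Phi_{eq}(\mathbf{x}))$, and $\pi_{\tilde g}$ denotes the action of $\tilde g$ on images (left side) and on feature maps (right side).
   Context: **Group.** For $k\in\{0,\dots,n-1\}$ and $m\in\{0,1\}$ let $$g(k,m)=\begin{bmatrix}(-1)^m\cos\frac{2\pi k}{n}&-(-1)^m\sin\frac{2\pi k}{n}\\ \sin\frac{2\pi k}{n}&\cos\frac{2\pi k}{n}\end{bmatrix}.$$ $S$ is the group of all $g(k,m)$, or only of the rotations $g(k,0)$, where the rotations are by multiples of $\pi/2$, i.e. $n\in\{1,2,4\}$. Write $t=|S|$. **Images, features, group action.** An array of spatial size $a\times b$ is regarded as a function on the centred grid $X_{a,b}=\{(i-\frac{a-1}{2},\,j-\frac{b-1}{2}):0\le i<a,\ 0\le j<b\}$. For a function $f$ on such a grid and $g\in S$, $\pi(g)f$ is the function on the transformed grid given by $(\pi(g)f)(u)=f(g^{-1}u)$. An image of size $H\times W\times c_0$ is a function $X_{H,W}\to\mathbb{R}^{c_0}$,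 and $\pi_{\tilde g}(\mathbf{x})=\pi(\tilde g)\mathbf{x}$. A feature with $c$ channels on an $a\times b$ grid is a family $\bm z=(\bm z^B)_{B\in S}$ of functions $\bm z^B:X_{a,b}\to\mathbb{R}^c$ (row vectors). With $N=ab$ tokens (the grid points), it is an element of $\mathbb{R}^{N\times c\times t}$, and $\bm z^B\in\mathbb{R}^{N\times c}$ is its slice at group index $B$. The action on features is $(\pi_{\tilde g}\bm z)^B=\pi(\tilde g)\,\bm z^{\tilde g^{-1}B}$ (spatial transformation together with a shift of the group index). **Equivariant down/up-sampling.** Let $\mathrm{Down}_s$ be the ordinary stride-$s$ down-sampling of arrays and $\mathrm{PS}_r$ the standard Pixel-Shuffle, which rearranges an array with $r^2c$ channels into one with $c$ channels and $r$ times larger height and width. The equivariant versions act on each slice by $\bm z^g\mapsto[\pi(g)\circ\mathrm{Down}_s\circ\pi(g^{-1})](\bm z^g)$ and $\bm z^g\mapsto[\pi(g)\circ\mathrm{PS}_r\circ\pi(g^{-1})](\bm z^g)$, $g\in S$. **Equivariant patch embedding.** With a learnable convolution kernel $\psi$ on a centred square grid ($c_0$ input and $c$ output channels), the embedding of $\mathbf{x}$ has slices $D_s(\pi_g(\psi)\otimes\mathbf{x})$, $g\in S$. Here $\pi_g(\psi)=\psi(g^{-1}\,\cdot)$ is the kernel transformed by $g$, $\otimes$ is 2D convolution (with symmetric zero padding, if any), and $D_s$ is the equivariant stride-$s$ down-sampling above applied to the slice with index $g$. The result has spatial size $\frac Hs\times\frac Ws$, so $N=HW/s^2$ tokens. **Equivariant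 linear layer.** With learnable matrices $\bm W_g$, $g\in S$, it maps $\bm z$ to the feature with slices $\sum_{g\in S}\bm z^g\,\bm W_{B^{-1}g}$, $B\in S$. **Equivariant self-attention.** $\bm q,\bm k,\bm v\in\mathbb{R}^{N\times c\times t}$ are obtained from the input $\bm z\in\mathbb{R}^{N\times c\times t}$ by three equivariant linear layers with learnable families $\bm W^{q}_g,\bm W^{k}_g,\bm W^{v}_g\in\mathbb{R}^{c\times c}$, $g\in S$. They are reshaped (channel and group dimensions flattened in the same order) to $\bm Q,\bm K,\bm V\in\mathbb{R}^{N\times ct}$. Then $$\bm A=\operatorname{Softmax}\big(\bm Q\bm K^\top/\sqrt{ct}\big)\ \text{(row-wise)},$$ and the output is $\bm A\bm V$, reshaped to $\mathbb{R}^{N\times c\times t}$. The multi-head version runs several such computations in parallel (each head keeping the full group dimension, with its own number of channels $c$) and aggregates their outputs by equivariant linear layers. **Equivariant positional encodings.** *Absolute:* $\mathrm{PE}_S(p)=\mathrm{APE}(p_c)$, where $p_c$ is the lexicographically smallest element of the orbit $\{g(p):g\in S\}$ of the token position $p$ and $\mathrm{APE}$ is a learnable table of vectors in $\mathbb{R}^c$. It is added to the token at $p$, the same vector for every group index. *Relative:* $\mathrm{PE}^{\mathrm{rel}}(p_i,p_j)=\mathrm{RPE}(p_{jc}-p_{ic})$, where $(p_{ic},p_{jc})$ is the lexicographically smallest pair (as a 4-tuple) in $\{(g(p_i),g(p_j)):g\in D_4\}$, $D_4$ is the group of the eight symmetries of the square, and $\mathrm{RPE}$ is a learnable scalar function.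 It is added as a bias to the $(i,j)$ entry of the scaled dot products $\bm Q\bm K^\top/\sqrt{ct}$. **Equivariant layer normalization.** Ordinary layer normalization of the $ct$ entries of each token, followed by a learnable channel-wise scaling $\bm\gamma$ and shift $\bm\beta$ that are shared along the group dimension. **Equivariant vision transformer.** $\Phi_{eq}$ first applies the equivariant patch embedding, optionally adding the absolute encoding, to obtain $\bm z_0$. It then applies $L$ blocks $$\bm z'_\ell=\mathrm{SA}_\ell(\mathrm{LN}_\ell(\bm z_{\ell-1}))+\bm z_{\ell-1},\qquad \bm z_\ell=\mathrm{MLP}_\ell(\mathrm{LN}'_\ell(\bm z'_\ell))+\bm z'_\ell,\qquad \ell=1,\dots,L,$$ where $\mathrm{SA}_\ell$ is equivariant self-attention (single- or multi-head, with or without relative encoding), $\mathrm{LN}_\ell,\mathrm{LN}'_\ell$ are equivariant layer normalizations, and $\mathrm{MLP}_\ell$ consists of equivariant linear layers with an entrywise activation such as GELU. Equivariant down- or up-sampling layers and equivariant linear layers may be inserted between or after the blocks. Its output is a feature. The same parameters are used for $\mathbf{x}$ and for $\pi_{\tilde g}(\mathbf{x})$. *)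

(* Defs.v *)
(* MathComp / MathComp-Analysis; the real numbers are an arbitrary realType. *)
From HB Require Import structures.
From mathcomp Require Import all_boot all_order all_algebra.
From mathcomp Require Import interval_inference reals sequences exp trigo.

Set Implicit Arguments.
Unset Strict Implicit.
Unset Printing Implicit Defensive.

Import Order.TTheory GRing.Theory Num.Theory.
Local Open Scope ring_scope.

Section Group.
Context (R : realType).

Definition gmat (n k : nat) (m : bool) : 'M[R]_2 :=
  let th := 2 * pi * k%:R / n%:R in
  \matrix_(i < 2, j < 2)
    (nth [::] [:: [:: (-1) ^+ m * cos th; - ((-1) ^+ m * sin th)];
                  [:: sin th;             cos th]] i)`_j.

Definition sym_seq (n : nat) (refl : bool) : seq 'M[R]_2 :=
  [seq gmat n k m | k <- iota 0 n,
                    m <- if refl then [:: false; true] else [:: false]].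

(* The group S, as a finite type of matrices: all the g(k, m) if refl holds,
   only the rotations g(k, 0) otherwise. *)
Definition symgrp (n : nat) (refl : bool) : finType := seq_sub (sym_seq n refl).

(* The element x^-1 y of S.  As S is closed under this operation, the default
   value x of insubd is never used. *)
Definition sym_ldiv n refl (x y : symgrp n refl) : symgrp n refl :=
  insubd x (invmx (ssval x) *m ssval y).

End Group.

Section Arrays.
Context (R : realType).

(* An array of size a x b with entries in V has type 'M[V]_(a, b); its entry
   (i, j) sits at the point grid_pos a b i j of the plane. *)
Definition grid_pos (a b i j : nat) : 'cV[R]_2 :=
  \col_(k < 2) [:: i%:R - (a%:R - 1) / 2; j%:R - (b%:R - 1) / 2]`_k.

(* The value at u of f, seen as a function on its grid extended by 0. *)
Definition at_point (V : nmodType) a b (f : 'M[V]_(a, b)) (u : 'cV[R]_2) : V :=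
  if [pick p : 'I_a * 'I_b | grid_pos a b p.1 p.2 == u] is Some p
  then f p.1 p.2 else 0.

(* The function u |-> f (g^-1 u) on the grid of size h x w. *)
Definition gact_to (V : nmodType) h w (g : 'M[R]_2) a b (f : 'M[V]_(a, b)) :
    'M[V]_(h, w) :=
  \matrix_(i < h, j < w) at_point f (invmx g *m grid_pos h w i j).

(* The size of the image under g of the grid of size a x b, for g a symmetry
   of the square: g exchanges the two axes iff its top left entry vanishes. *)
Definition gact_h (g : 'M[R]_2) (a b : nat) : nat := if g 0 0 == 0 then b else a.
Definition gact_w (g : 'M[R]_2) (a b : nat) : nat := if g 0 0 == 0 then a else b.

Definition gact (V : nmodType) (g : 'M[R]_2) a b (f : 'M[V]_(a, b)) :
    'M[V]_(gact_h g a b, gact_w g a b) :=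
  gact_to (gact_h g a b) (gact_w g a b) g f.

(* Indexing by natural numbers, with value 0 out of range. *)
Definition entry (V : nmodType) a b (A : 'M[V]_(a, b)) (i j : nat) : V :=
  match insub i, insub j with
  | Some i', Some j' => A i' j'
  | _, _ => 0
  end.

(* a / s rounded up: the number of multiples of s in {0, ..., a - 1}. *)
Definition down_size (s a : nat) : nat := ((a + s.-1) %/ s)%N.

Definition down (V : nmodType) s a b (f : 'M[V]_(a, b)) :
    'M[V]_(down_size s a, down_size s b) :=
  \matrix_(i, j) entry f (s * i) (s * j).

(* Input channel l * r^2 + i * r + j gives the entry (i, j) of the r x r cells
   of output channel l. *)
Definition pixel_shuffle r c a b (f : 'M['rV[R]_(r ^ 2 * c)]_(a, b)) :
    'M['rV[R]_c]_(r * a, r * b) :=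
  \matrix_(i, j) \row_(l < c)
    entry (entry f (i %/ r) (j %/ r)) 0 (l * r ^ 2 + (i %% r) * r + j %% r).

Definition equi_down (V : nmodType) s (g : 'M[R]_2) a b (f : 'M[V]_(a, b)) :
    'M[V]_(down_size s a, down_size s b) :=
  gact_to _ _ g (down s (gact (invmx g) f)).

Definition equi_pixel_shuffle r c (g : 'M[R]_2) a b
    (f : 'M['rV[R]_(r ^ 2 * c)]_(a, b)) : 'M['rV[R]_c]_(r * a, r * b) :=
  gact_to _ _ g (pixel_shuffle (gact (invmx g) f)).

Definition conv_size (p pad a : nat) : nat := (a + 2 * pad + 1 - p)%N.

(* Convolution with a p x p kernel of x, zero-padded by pad on all four sides:
   the value at u is the sum over v of x(u - v) psi(v). *)
Definition conv p pad c0 c H W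
    (psi : 'M['M[R]_(c0, c)]_(p, p)) (x : 'M['rV[R]_c0]_(H, W)) :
    'M['rV[R]_c]_(conv_size p pad H, conv_size p pad W) :=
  \matrix_(i, j) \sum_(k < p) \sum_(l < p)
    at_point x (grid_pos (conv_size p pad H) (conv_size p pad W) i j
                - grid_pos p p k l) *m psi k l.

Definition softmax m k (A : 'M[R]_(m, k)) : 'M[R]_(m, k) :=
  \matrix_(i, j) (expR (A i j) / \sum_(l < k) expR (A i l)).

End Arrays.

Section Layers.
Context (R : realType) (n : nat) (refl : bool).

Local Notation S := (symgrp R n refl).

Definition feature_map (c h w : nat) := {ffun S -> 'M['rV[R]_c]_(h, w)}.

Definition feature_down s c h w (z : feature_map c h w) :
    feature_map c (down_size s h) (down_size s w) :=
  [ffun g : S => equi_down s (ssval g) (z g)].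

Definition feature_up r c h w (z : feature_map (r ^ 2 * c) h w) :
    feature_map c (r * h) (r * w) :=
  [ffun g : S => equi_pixel_shuffle (ssval g) (z g)].

Definition patch_embed p pad s c0 c (psi : 'M['M[R]_(c0, c)]_(p, p))
    H W (x : 'M['rV[R]_c0]_(H, W)) :
    feature_map c (down_size s (conv_size p pad H))
                  (down_size s (conv_size p pad W)) :=
  [ffun g : S => equi_down s (ssval g) (conv pad (gact_to p p (ssval g) psi) x)].

Definition equi_linear c c' (Wt : S -> 'M[R]_(c, c')) h w
    (z : feature_map c h w) : feature_map c' h w :=
  [ffun B => \matrix_(i < h, j < w)
    \sum_(g : S) z g i j *m Wt (sym_ldiv B g)].

Definition lexmin (T : Type) (key : T -> seqlexi R) (x y : T) : T :=
  if (key x <= key y)%O then x else y.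

Definition coords (p : 'cV[R]_2) : seqlexi R := [:: p 0 0; p 1 0].

Definition canon (p : 'cV[R]_2) : 'cV[R]_2 :=
  \big[lexmin coords/p]_(g : S) (ssval g *m p).

(* The orbit is taken under the dihedral group of order 8, whatever S is. *)
Definition canon_pair (p q : 'cV[R]_2) : 'cV[R]_2 * 'cV[R]_2 :=
  \big[lexmin (fun u => coords u.1 ++ coords u.2)/(p, q)]_(g : symgrp R 4 true)
    (ssval g *m p, ssval g *m q).

Definition add_ape c (ape : option ('cV[R]_2 -> 'rV[R]_c)) h w
    (z : feature_map c h w) : feature_map c h w :=
  if ape is Some e then
    [ffun B => \matrix_(i, j) (z B i j + e (canon (grid_pos R h w i j)))]
  else z.

Definition rel_bias (rpe : option ('cV[R]_2 -> R)) h w :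
    'M[R]_#|{: 'I_h * 'I_w}| :=
  if rpe is Some f then
    \matrix_(i, j)
      let pq := canon_pair
        (grid_pos R h w (enum_val i : 'I_h * 'I_w).1 (enum_val i : 'I_h * 'I_w).2)
        (grid_pos R h w (enum_val j : 'I_h * 'I_w).1 (enum_val j : 'I_h * 'I_w).2)
      in f (pq.2 - pq.1)
  else 0.

Definition flatten_map c h w (z : feature_map c h w) :
    'M[R]_(#|{: 'I_h * 'I_w}|, #|{: 'I_c * S}|) :=
  \matrix_(i, j)
    z (enum_val j).2 (enum_val i).1 (enum_val i).2 0 (enum_val j).1.

Definition unflatten_map c h w
    (A : 'M[R]_(#|{: 'I_h * 'I_w}|, #|{: 'I_c * S}|)) : feature_map c h w :=
  [ffun B => \matrix_(i, j) \row_l A (enum_rank (i, j)) (enum_rank (l, B))].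

Record attn_head (c d : nat) := AttnHead {
  Wq : S -> 'M[R]_(c, d);
  Wk : S -> 'M[R]_(c, d);
  Wv : S -> 'M[R]_(c, d);
  head_rpe : option ('cV[R]_2 -> R)
}.

Definition head_eval c d (a : attn_head c d) h w (z : feature_map c h w) :
    feature_map d h w :=
  let Q := flatten_map (equi_linear (Wq a) z) in
  let K := flatten_map (equi_linear (Wk a) z) in
  let V := flatten_map (equi_linear (Wv a) z) in
  let A := softmax ((Num.sqrt (d * #|S|)%:R)^-1 *: (Q *m K^T)
                    + rel_bias (head_rpe a) h w) in
  unflatten_map (A *m V).

(* A head of a multi-head layer, with the linear layer that aggregates it. *)
Record out_head (c : nat) := OutHead {
  head_dim : nat;
  head_attn : attn_head c head_dim;
  head_out : S -> 'M[R]_(head_dim, c)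
}.

Inductive attention (c : nat) : Type :=
| SingleHead of attn_head c c
| MultiHead of seq (out_head c).

(* Summing one linear layer per head is the same as applying one linear layer
   to the concatenation of the heads along the channels. *)
Definition attention_eval c (a : attention c) h w (z : feature_map c h w) :
    feature_map c h w :=
  match a with
  | SingleHead hd => head_eval hd z
  | MultiHead hs =>
      \sum_(hd <- hs) equi_linear (head_out hd) (head_eval (head_attn hd) z)
  end.

Record layer_norm (c : nat) := LayerNorm {
  ln_eps : {nonneg R};
  ln_gamma : 'rV[R]_c;
  ln_beta : 'rV[R]_c
}.

Definition layer_norm_eval c (ln : layer_norm c) h w (z : feature_map c h w) :
    feature_map c h w :=
  let ct := (c * #|S|)%:R in
  let mean i j := (\sum_(B : S) \sum_(l < c) z B i j 0 l) / ct in
  let var i j :=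
    (\sum_(B : S) \sum_(l < c) (z B i j 0 l - mean i j) ^+ 2) / ct in
  [ffun B => \matrix_(i < h, j < w) \row_(l < c)
    ((z B i j 0 l - mean i j) / Num.sqrt (var i j + (ln_eps ln)%:num)
     * ln_gamma ln 0 l + ln_beta ln 0 l)].

Inductive mlp : nat -> nat -> Type :=
| MlpId c : mlp c c
| MlpLinear c c1 c2 of S -> 'M[R]_(c, c1) & mlp c1 c2 : mlp c c2
| MlpActivation c c1 of R -> R & mlp c c1 : mlp c c1.

Fixpoint mlp_eval c c' (m : mlp c c') h w :
    feature_map c h w -> feature_map c' h w :=
  match m with
  | MlpId _ => id
  | MlpLinear _ _ _ Wt m' => fun z => mlp_eval m' (equi_linear Wt z)
  | MlpActivation _ _ sigma m' => fun z =>
      mlp_eval m' [ffun B => map_mx (map_mx sigma) (z B)]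
  end.

Record block (c : nat) := Block {
  block_ln1 : layer_norm c;
  block_sa : attention c;
  block_ln2 : layer_norm c;
  block_mlp : mlp c c
}.

Definition block_eval c (b : block c) h w (z : feature_map c h w) :
    feature_map c h w :=
  let z' := attention_eval (block_sa b) (layer_norm_eval (block_ln1 b) z) + z in
  mlp_eval (block_mlp b) (layer_norm_eval (block_ln2 b) z') + z'.

(* The spatial size is part of a feature, so that equality of two features
   includes equality of their sizes. *)
Record feature (c : nat) := Feature {
  feature_h : nat;
  feature_w : nat;
  feature_val : feature_map c feature_h feature_w
}.

Definition feature_act c (g : S) (z : feature c) : feature c :=
  @Feature c (gact_h (ssval g) (feature_h z) (feature_w z))
             (gact_w (ssval g) (feature_h z) (feature_w z))
    [ffun B => gact (ssval g) (feature_val z (sym_ldiv g B))].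

Inductive inserts : nat -> nat -> Type :=
| InsNil c : inserts c c
| InsLinear c c1 c2 of S -> 'M[R]_(c, c1) & inserts c1 c2 : inserts c c2
| InsDown s c c1 of (0 < s)%N & inserts c c1 : inserts c c1
| InsUp r c c1 of (0 < r)%N & inserts c c1 : inserts (r ^ 2 * c) c1.

Fixpoint inserts_eval c c' (l : inserts c c') : feature c -> feature c' :=
  match l with
  | InsNil _ => id
  | InsLinear _ _ _ Wt l' => fun z =>
      inserts_eval l' (Feature (equi_linear Wt (feature_val z)))
  | InsDown s _ _ _ l' => fun z =>
      inserts_eval l' (Feature (feature_down s (feature_val z)))
  | InsUp _ _ _ _ l' => fun z =>
      inserts_eval l' (Feature (feature_up (feature_val z)))
  end.

(* trunk L c c': L blocks, each followed by any number of inserted layers. *)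
Inductive trunk : nat -> nat -> nat -> Type :=
| TrunkNil c : trunk 0 c c
| TrunkCons L c c1 c2 of block c & inserts c c1 & trunk L c1 c2 :
    trunk L.+1 c c2.

Fixpoint trunk_eval L c c' (t : trunk L c c') : feature c -> feature c' :=
  match t with
  | TrunkNil _ => id
  | TrunkCons _ _ _ _ b l t' => fun z =>
      trunk_eval t' (inserts_eval l (Feature (block_eval b (feature_val z))))
  end.

Record vit (c0 c L : nat) := ViT {
  vit_dim : nat;
  vit_ksize : nat;
  vit_pad : nat;
  vit_stride : nat;
  vit_stride_gt0 : (0 < vit_stride)%N;
  vit_kernel : 'M['M[R]_(c0, vit_dim)]_(vit_ksize, vit_ksize);
  vit_ape : option ('cV[R]_2 -> 'rV[R]_vit_dim);
  vit_trunk : trunk L vit_dim c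
}.

Definition vit_eval c0 c L (Phi : vit c0 c L) H W (x : 'M['rV[R]_c0]_(H, W)) :
    feature c :=
  trunk_eval (vit_trunk Phi)
    (Feature (add_ape (vit_ape Phi)
      (patch_embed (vit_pad Phi) (vit_stride Phi) (vit_kernel Phi) x))).

End Layers.

(* Main.v *)
Require Import Defs.
From HB Require Import structures.
From mathcomp Require Import all_boot all_order all_algebra.
From mathcomp Require Import interval_inference reals sequences exp trigo.
From mathcomp Require Import ring.

(** Every element of S is a signed permutation matrix, so it maps a centred grid
    bijectively onto the grid with possibly exchanged sides, and composing
    functions on grids with such matrices is a left action. Reindexing by this
    bijection and by the shift B |-> g^-1 B of the group commutes with every sum
    occurring in the layers that act on tokens, and both positional encodings are
    constant on orbits. Down- and up-sampling have the form pi(B) F pi(B^-1),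
    and pi(B) F pi(B^-1) pi(g) = pi(g) (pi(g^-1 B) F pi((g^-1 B)^-1)). *)

Set Implicit Arguments.
Unset Strict Implicit.
Unset Printing Implicit Defensive.

Import Order.TTheory GRing.Theory Num.Theory.
Local Open Scope ring_scope.

(** * Signed permutation matrices *)

(* The code (t, a, b) stands for the matrix with rows (-1)^a e_t and
   (-1)^b e_(1-t). *)
Definition code := (bool * bool * bool)%type.

(** The group law of the eight symmetries of the square, on Booleans, so that matrix identities
    become finite checks. *)
Definition code_mul (x y : code) : code :=
  let: (t, a, b) := x in let: (t', a', b') := y in
  (t (+) t', a (+) (if t then b' else a'), b (+) (if t then a' else b')).

(** The inverse of an orthogonal matrix is its transpose; transposing exchanges the two signs when
    the matrix is antidiagonal. *)
Definition code_inv (x : code) : code :=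
  let: (t, a, b) := x in if t then (t, b, a) else x.

(* The code of diag((-1)^m, 1) times the rotation by q quarter turns. *)
Definition turn (q : nat) (m : bool) : code :=
  (odd q, m (+) ((q == 1) || (q == 2)), 1 < q)%N.

(** As n divides 4, the angle 2 pi k / n amounts to [k * (4 %/ n)] quarter turns. *)
Definition codes (n : nat) (refl : bool) : seq code :=
  [seq turn (k * (4 %/ n)) m | k <- iota 0 n,
                               m <- if refl then [:: false; true] else [:: false]].

Definition order_ok (n : nat) := n = 1%N \/ n = 2%N \/ n = 4%N.

Lemma order_ok4 : order_ok 4.
Proof. by right; right. Qed.

(** The subgroup criterion, verified by evaluation for each of the six choices of [n] and [refl]. *)
Lemma codes_group n refl : order_ok n ->
  turn 0 false \in codes n refl /\
  {in codes n refl &, forall x y, code_mul (code_inv x) y \in codes n refl}.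
Proof.
move=> hn; split; first by case: hn => [|[]] ->; case: refl.
suff /allP h : all (fun x => all (fun y => code_mul (code_inv x) y \in codes n refl)
    (codes n refl)) (codes n refl) by move=> x y /h/allP; apply.
by case: hn => [|[]] ->; case: refl.
Qed.

Lemma codes_full x : x \in codes 4 true.
Proof. by case: x => -[[] []] []. Qed.

Lemma code_invK : involutive code_inv.
Proof. by case=> -[[] []] []. Qed.

Section SignedPerm.
Context (R : realType).

Definition smx (x : code) : 'M[R]_2 :=
  let: (t, a, b) := x in
  \matrix_(i, j) (((j == i) != t)%:R * (-1) ^+ (if i == 0 then a else b)).

Lemma smx1 : smx (turn 0 false) = 1%:M.
Proof.
apply/matrixP=> i j; rewrite !mxE.
by case: i => -[|[|//]] ?; case: j => -[|[|//]] ?; rewrite /= ?mul0r ?mulr1.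
Qed.

Lemma smxM x y : smx x *m smx y = smx (code_mul x y).
Proof.
case: x => -[t a] b; case: y => -[t' a'] b'.
apply/matrixP=> i j; rewrite !mxE !big_ord_recl big_ord0 !mxE /=.
case: i => -[|[|//]] ?; case: j => -[|[|//]] ?;
case: t; case: t'; case: a; case: a'; case: b; case: b';
rewrite /= ?expr0 ?expr1; ring.
Qed.

Lemma smxV x : smx (code_inv x) *m smx x = 1%:M.
Proof. by rewrite smxM -smx1; congr smx; case: x => -[[] []] []. Qed.

Lemma smx_unit x : smx x \in unitmx.
Proof. by have [] := mulmx1_unit (smxV x). Qed.

Lemma invmx_smx x : invmx (smx x) = smx (code_inv x).
Proof. by rewrite -[RHS]mulmx1 -(mulmxV (smx_unit x)) mulmxA smxV mul1mx. Qed.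

(** The hypothesis [k * 4 = q * n] says that the angle is [q] quarter turns, so its cosine and sine
    are 0 or a sign. *)
Lemma gmat_turn n q k m : (0 < n)%N -> (k * 4 = q * n)%N -> (q < 4)%N ->
  gmat R n k m = smx (turn q m).
Proof.
move=> n0 kq q4; apply/matrixP=> i j; rewrite !mxE.
have nR : n%:R != 0 :> R by rewrite pnatr_eq0 -lt0n.
have -> : 2 * pi * k%:R / n%:R = (pi / 2) * q%:R :> R.
  by apply: (mulIf nR); rewrite mulfVK // -[RHS]mulrA -natrM -kq natrM; field.
have st u : pi / 2 * u.+1%:R = pi / 2 * u%:R + pi / 2 :> R.
  by rewrite -[u.+1%:R]natr1 mulrDr mulr1.
have Ec : cos (pi / 2 * q%:R) = (if odd q then 0 else (-1) ^+ (1 < q)%N) :> R.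
  by case: q q4 {kq} => [|[|[|[|//]]]] _; rewrite ?st ?(cosDpihalf, sinDpihalf)
    mulr0 ?cos0 ?sin0 ?oppr0 ?opprK.
have Es : sin (pi / 2 * q%:R) = (if odd q then (-1) ^+ (1 < q)%N else 0) :> R.
  by case: q q4 {kq Ec} => [|[|[|[|//]]]] _; rewrite ?st ?(cosDpihalf, sinDpihalf)
    mulr0 ?cos0 ?sin0 ?oppr0 ?opprK.
rewrite Ec Es.
case: q q4 {kq Ec Es} => [|[|[|[|//]]]] _; case: m;
case: i => -[|[|//]] ?; case: j => -[|[|//]] ?; rewrite /= ?expr0 ?expr1; ring.
Qed.

Lemma sym_seqE n refl : order_ok n -> sym_seq R n refl = map smx (codes n refl).
Proof.
move=> hn; rewrite /sym_seq /codes map_allpairs.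
apply/eq_in_allpairs => k m; rewrite mem_iota add0n => /andP[_ kn] _.
by case: hn kn => [|[]] -> kn; apply: gmat_turn => //;
  case: k kn => [|[|[|[|//]]]].
Qed.

End SignedPerm.

(** * Lexicographic minima *)

(** The order being total, [lexmin] returns one of its arguments and lies below both; starting the
    fold at [F e] makes the minimum attained. *)
Lemma lexmin_big (R : realType) (T : Type) (key : T -> seqlexi R) (I : finType)
    (F : I -> T) (e : I) (m := \big[lexmin key/F e]_i F i) :
  (exists i, m = F i) /\ (forall i, (key m <= key (F i))%O).
Proof.
have lexminE x y : (lexmin key x y = x \/ lexmin key x y = y) /\
    (key (lexmin key x y) <= key x)%O && (key (lexmin key x y) <= key y)%O.
  rewrite /lexmin; case: leP => [xy|/ltW yx]; rewrite lexx ?andbT //.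
  - by split; [left | rewrite xy].
  - by split; [right | rewrite yx].
rewrite {}/m; split.
  elim/big_ind: _ => [|x y [i ->] [j ->]|i _]; [by exists e| |by exists i].
  by case: (lexminE (F i) (F j)) => -[->|->] _; [exists i | exists j].
move=> i; have := mem_index_enum i.
elim: (index_enum I) => // j s IHs; rewrite big_cons inE.
set y := \big[_/_]_(k <- s) _ in IHs *.
have [_ /andP[l1 l2]] := lexminE (F j) y.
by case/predU1P => [-> //|/IHs]; apply: le_trans.
Qed.

(* The value of the fold does not depend on its starting point, as long as the
   latter is one of the values. *)
Lemma eq_lexmin_big (R : realType) (T : Type) (key : T -> seqlexi R)
    (I J : finType) (F : I -> T) (G : J -> T) (x y : T) (e : I) (e' : J) :
  injective key -> x = F e -> y = G e' ->
  (forall i, exists j, F i = G j) -> (forall j, exists i, G j = F i) ->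
  \big[lexmin key/x]_i F i = \big[lexmin key/y]_j G j.
Proof.
move=> keyI -> -> FG GF; apply: keyI.
have [[i Ei] leF] := lexmin_big key F e; have [[j Ej] leG] := lexmin_big key G e'.
apply/le_anti/andP; split.
- by rewrite [X in (_ <= key X)%O]Ej; have [k ->] := GF j; apply: leF.
- by rewrite [X in (_ <= key X)%O]Ei; have [k ->] := FG i; apply: leG.
Qed.

(** * The group S and its orbits *)

Section SymGroup.
Context (R : realType) (n : nat) (refl : bool) (hn : order_ok n).

Local Notation S := (symgrp R n refl).

Lemma sym_code (g : S) : exists2 x, x \in codes n refl & ssval g = smx R x.
Proof. by apply/mapP; rewrite -sym_seqE //; apply: ssvalP. Qed.

Lemma code_sym x : x \in codes n refl -> exists g : S, ssval g = smx R x.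
Proof.
move=> xC; have xS : smx R x \in sym_seq R n refl by rewrite sym_seqE // map_f.
by exists (SeqSub xS).
Qed.

Lemma sym_unit (g : S) : ssval g \in unitmx.
Proof. by have [x _ ->] := sym_code g; apply: smx_unit. Qed.

(** Closure of the codes under x^-1 y ensures that [insubd] does not fall back on its default. *)
Lemma ssval_ldiv (g h : S) : ssval (sym_ldiv g h) = invmx (ssval g) *m ssval h.
Proof.
have [x xC Ex] := sym_code g; have [y yC Ey] := sym_code h.
rewrite /sym_ldiv insubdK // Ex Ey invmx_smx smxM sym_seqE //.
by apply: map_f; have [_ ->] := codes_group refl hn.
Qed.

Lemma ldivK (g h : S) : ssval g *m ssval (sym_ldiv g h) = ssval h.
Proof. by rewrite ssval_ldiv mulKVmx // sym_unit. Qed.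

Lemma ldiv_bij (g : S) : bijective (sym_ldiv g).
Proof.
apply: injF_bij => x y E; apply: val_inj.
by rewrite /= -(ldivK g x) E ldivK.
Qed.

Lemma ldiv_ldiv (g x y : S) : sym_ldiv (sym_ldiv g x) (sym_ldiv g y) = sym_ldiv x y.
Proof.
apply: val_inj; rewrite /= [RHS]ssval_ldiv -(ldivK g y).
by rewrite -(ldivK (sym_ldiv g x) (sym_ldiv g y)) mulmxA ldivK mulKmx ?sym_unit.
Qed.

Lemma sym_id : exists e : S, ssval e = 1%:M.
Proof.
have [C1 _] := codes_group refl hn.
by have [e Ee] := code_sym C1; exists e; rewrite Ee smx1.
Qed.

Lemma sym_inv (g : S) : exists k : S, ssval k = invmx (ssval g).
Proof.
by have [e Ee] := sym_id; exists (sym_ldiv g e); rewrite ssval_ldiv Ee mulmx1.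
Qed.

Lemma sym_mul (g h : S) : exists k : S, ssval k = ssval g *m ssval h.
Proof.
have [k Ek] := sym_inv g.
by exists (sym_ldiv k h); rewrite ssval_ldiv Ek invmxK.
Qed.

(** Right multiplication by g^-1 permutes S, so both folds run over the same values, each starting
    at its value at the identity. A general [f] covers single positions and pairs alike. *)
Lemma eq_lexmin_orbit (T : Type) (key : T -> seqlexi R) (f : 'M[R]_2 -> T) (g : S) :
  injective key ->
  \big[lexmin key/f (invmx (ssval g))]_(i : S) f (ssval i *m invmx (ssval g)) =
  \big[lexmin key/f 1%:M]_(i : S) f (ssval i).
Proof.
move=> keyI; have [e Ee] := sym_id; have [g' Eg] := sym_inv g.
apply: (@eq_lexmin_big R T key S S _ _ _ _ e e keyI); rewrite ?Ee ?mul1mx // => i.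
- by rewrite -Eg; have [j <-] := sym_mul i g'; exists j.
- by have [j Ej] := sym_mul i g; exists j; rewrite Ej mulmxK // sym_unit.
Qed.

Lemma coords_inj : injective (@coords R).
Proof.
move=> p q [E0 E1]; apply/matrixP=> i j; rewrite [j]ord1.
by case: i => -[|[|//]] ?; [move: E0 | move: E1]; congr (_ = _); congr (_ _ _);
  apply: val_inj.
Qed.

Lemma canon_sym (g : S) (p : 'cV[R]_2) :
  canon n refl (invmx (ssval g) *m p) = canon n refl p.
Proof.
rewrite /canon; have := eq_lexmin_orbit (fun M => M *m p) g coords_inj.
rewrite /= mul1mx => <-.
by apply: eq_bigr => i _; rewrite mulmxA.
Qed.

End SymGroup.

Lemma canon_pair_sym (R : realType) (g : symgrp R 4 true) (p q : 'cV[R]_2) :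
  canon_pair (invmx (ssval g) *m p) (invmx (ssval g) *m q) = canon_pair p q.
Proof.
pose key (u : 'cV[R]_2 * 'cV[R]_2) : seqlexi R := coords u.1 ++ coords u.2.
have keyI : injective key.
  by move=> [u1 u2] [v1 v2] [*]; congr (_, _); apply: coords_inj; congr [:: _; _].
rewrite /canon_pair.
have := eq_lexmin_orbit order_ok4 (fun M => (M *m p, M *m q)) g keyI.
rewrite /= !mul1mx => <-.
by apply: eq_bigr => i _; rewrite !mulmxA.
Qed.

(** All eight signed permutations lie in the dihedral group defining the orbit, hence so does every
    element of any S. *)
Lemma canon_pair_smx (R : realType) x (p q : 'cV[R]_2) :
  canon_pair (invmx (smx R x) *m p) (invmx (smx R x) *m q) = canon_pair p q.
Proof.
by have [g <-] := code_sym R order_ok4 (codes_full x); apply: canon_pair_sym.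
Qed.

(** * Functions on centred grids *)

(** Sizes of the image grid are kept as variables with equations, since the sizes produced by
    different layers agree with [gact_h] and [gact_w] only provably. *)
Definition fits (R : realType) (g : 'M[R]_2) (h w h' w' : nat) :=
  h' = gact_h g h w /\ w' = gact_w g h w.

Section Grids.
Context (R : realType).

Lemma gact_h_smx t a b h w : gact_h (smx R (t, a, b)) h w = if t then w else h.
Proof.
rewrite /gact_h mxE /= mulf_eq0 signr_eq0 orbF pnatr_eq0 eqb0 negbK.
by case: t.
Qed.

Lemma gact_w_smx t a b h w : gact_w (smx R (t, a, b)) h w = if t then h else w.
Proof.
rewrite /gact_w mxE /= mulf_eq0 signr_eq0 orbF pnatr_eq0 eqb0 negbK.
by case: t.
Qed.

Definition gact_smx := (gact_h_smx, gact_w_smx).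

Lemma fitsV x h w h' w' :
  fits (smx R x) h w h' w' -> fits (invmx (smx R x)) h' w' h w.
Proof.
by case: x => -[t a] b; rewrite invmx_smx /fits; case: t => /=;
  rewrite !gact_smx => -[-> ->].
Qed.

Lemma fitsM x y h w h' w' h'' w'' :
  fits (smx R x) h w h' w' -> fits (smx R y) h' w' h'' w'' ->
  fits (smx R y *m smx R x) h w h'' w''.
Proof.
case: x => -[t a] b; case: y => -[t' a'] b'; rewrite smxM /fits !gact_smx.
by case: t; case: t' => -[-> ->] [-> ->].
Qed.

Lemma fits_map (phi : nat -> nat) x h w h' w' :
  fits (smx R x) h w h' w' -> fits (smx R x) (phi h) (phi w) (phi h') (phi w').
Proof. by case: x => -[t a] b; rewrite /fits !gact_smx; case: t => -[-> ->]. Qed.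

Lemma fits_square x p : fits (smx R x) p p p p.
Proof. by case: x => -[[] a] b; rewrite /fits !gact_smx. Qed.

Lemma grid_pos_inj a b (p q : 'I_a * 'I_b) :
  grid_pos R a b p.1 p.2 = grid_pos R a b q.1 q.2 -> p = q.
Proof.
move=> /matrixP E; have := E 0 0; have := E 1 0; rewrite !mxE /=.
move=> /addIr/eqP; rewrite eqr_nat => /eqP/val_inj E2.
move=> /addIr/eqP; rewrite eqr_nat => /eqP/val_inj E1.
by case: p q E1 E2 {E} => ? ? [? ?] /= -> ->.
Qed.

Lemma at_point_grid (V : nmodType) a b (f : 'M[V]_(a, b)) (p : 'I_a * 'I_b) :
  at_point f (grid_pos R a b p.1 p.2) = f p.1 p.2.
Proof.
rewrite /at_point; case: pickP => [q /eqP/grid_pos_inj -> //|/(_ p)].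
by rewrite eqxx.
Qed.

Definition flip k (e : bool) (i : 'I_k) : 'I_k := if e then rev_ord i else i.

(** Because the grid is centred, reversing the indices negates the coordinate. *)
Lemma flipE k e (i : 'I_k) :
  (flip e i)%:R - (k%:R - 1) / 2 = (-1) ^+ e * (i%:R - (k%:R - 1) / 2) :> R.
Proof.
case: e; rewrite /= ?mul1r // expr1 natrB ?ltn_ord // -[i.+1%:R]natr1; by field.
Qed.

(** The map u |-> g^-1 u on indices, from the image grid back to the original one. *)
Definition grid_map (g : 'M[R]_2) h w h' w' (s : 'I_h' * 'I_w' -> 'I_h * 'I_w) :=
  bijective s /\
  forall p, grid_pos R h w (s p).1 (s p).2 = invmx g *m grid_pos R h' w' p.1 p.2.

Lemma grid_mapP x h w h' w' : fits (smx R x) h w h' w' ->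
  exists s : 'I_h' * 'I_w' -> 'I_h * 'I_w, grid_map (smx R x) s.
Proof.
move=> fx.
have [s posE] : exists s : 'I_h' * 'I_w' -> 'I_h * 'I_w, forall p,
    grid_pos R h w (s p).1 (s p).2 = invmx (smx R x) *m grid_pos R h' w' p.1 p.2.
  case: x fx => -[t a] b; rewrite /fits !gact_smx invmx_smx.
  case: t => -[-> ->].
  (* The inverse has rows (-1)^b e_1 and (-1)^a e_0, whence the order of the flips. *)
  - exists (fun p => (flip b p.2, flip a p.1)) => p.
    apply/matrixP=> i j; rewrite !mxE !big_ord_recl big_ord0 !mxE /=.
    by case: i => -[|[|//]] ?; rewrite /= flipE; ring.
  - exists (fun p => (flip a p.1, flip b p.2)) => p.
    apply/matrixP=> i j; rewrite !mxE !big_ord_recl big_ord0 !mxE /=.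
    by case: i => -[|[|//]] ?; rewrite /= flipE; ring.
exists s; split=> //; apply: inj_card_bij => [p q Epq|].
  have := posE p; rewrite Epq posE => /(congr1 (mulmx (smx R x))).
  by rewrite !mulKVmx ?smx_unit // => /grid_pos_inj.
rewrite !card_prod !card_ord.
case: x fx {s posE} => -[t a] b; rewrite /fits !gact_smx.
by case: t => -[-> ->] //; rewrite mulnC.
Qed.

Lemma gact_to_map (V : nmodType) g h w h' w' (f : 'M[V]_(h, w))
    (s : 'I_h' * 'I_w' -> 'I_h * 'I_w) (p : 'I_h' * 'I_w') :
  grid_map g s -> gact_to h' w' g f p.1 p.2 = f (s p).1 (s p).2.
Proof. by move=> [_ posE]; rewrite mxE -posE at_point_grid. Qed.

(** Here [u] is any point of the plane: off the image grid both sides are 0. This is what handles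
    zero padding. *)
Lemma at_point_gact_to (V : nmodType) x h w h' w' (f : 'M[V]_(h, w)) u :
  fits (smx R x) h w h' w' ->
  at_point (gact_to h' w' (smx R x) f) u = at_point f (invmx (smx R x) *m u).
Proof.
move=> /grid_mapP[s sP]; have [[s' _ s'K] posE] := sP.
rewrite {1}/at_point; case: pickP => [p /eqP <-|nu].
  by rewrite (gact_to_map _ _ sP) -posE at_point_grid.
rewrite /at_point; case: pickP => [q /eqP Eq|//].
(* If g^-1 u were the grid point [q], then [u] would be the point [s' q] of the image grid. *)
case/eqP: (negbT (nu (s' q))).
by rewrite -[LHS](mulKVmx (smx_unit R x)) -posE s'K Eq mulKVmx ?smx_unit.
Qed.

Lemma gact_toM (V : nmodType) x y h w h' w' h'' w'' (f : 'M[V]_(h, w)) :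
  fits (smx R x) h w h' w' ->
  gact_to h'' w'' (smx R y) (gact_to h' w' (smx R x) f) =
  gact_to h'' w'' (smx R y *m smx R x) f.
Proof.
move=> fx; apply/matrixP=> i j; rewrite !mxE at_point_gact_to // mulmxA.
rewrite smxM !invmx_smx smxM; congr (at_point _ (smx R _ *m _)).
by case: x {fx f} => -[[] []] []; case: y => -[[] []] [].
Qed.

End Grids.

(** * Sampling, convolution and patch embedding *)

Section Sampled.
Context (R : realType) (V V' : nmodType) (phi : nat -> nat).
Context (F : forall a b, 'M[V]_(a, b) -> 'M[V']_(phi a, phi b)).

(* The common form of the equivariant down- and up-sampling. *)
Definition sampled (g : 'M[R]_2) a b (f : 'M[V]_(a, b)) : 'M[V']_(phi a, phi b) :=
  gact_to _ _ g (F (gact (invmx g) f)).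

(** With y = x z, the map [F] is applied on both sides to the same array, as pi(y^-1) pi(x) f =
    pi(z^-1) f. *)
Lemma sampled_gact x y a b a' b' (f : 'M[V]_(a, b)) :
  fits (smx R x) a b a' b' ->
  sampled (smx R y) (gact_to a' b' (smx R x) f) =
  gact_to (phi a') (phi b') (smx R x) (sampled (invmx (smx R x) *m smx R y) f).
Proof.
move=> fx; rewrite invmx_smx smxM; set z := code_mul _ _.
have yE : y = code_mul x z.
  by rewrite /z; case: x {fx z f} => -[[] []] []; case: y => -[[] []] [].
have fz : fits (smx R z) (gact_h (invmx (smx R z)) a b)
    (gact_w (invmx (smx R z)) a b) a b.
  by rewrite invmx_smx -{1}[z]code_invK -invmx_smx; apply: fitsV.
have zE : smx R (code_inv y) *m smx R x = invmx (smx R z).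
  rewrite invmx_smx smxM yE; congr smx.
  by case: x {fx f yE fz} @z => -[[] []] []; case: y => -[[] []] [].
rewrite /sampled gact_toM; last exact: (fits_map phi fz).
rewrite smxM -yE /gact [invmx (smx R y)]invmx_smx gact_toM // zE.
(* It remains to identify the two expressions for the size of that array. *)
have [-> -> //] : fits (invmx (smx R z)) a b (gact_h (smx R (code_inv y)) a' b')
    (gact_w (smx R (code_inv y)) a' b').
by rewrite -zE; apply: fitsM fx _.
Qed.

End Sampled.

(** The kernel grid is square, so g permutes it; substituting v = g v' in the sum turns g^-1 (u - v)
    into g^-1 u - v'. *)
Lemma conv_gact (R : realType) x p pad c0 c H W H' W'
    (psi : 'M['M[R]_(c0, c)]_(p, p)) (f : 'M['rV[R]_c0]_(H, W)) :
  fits (smx R x) H W H' W' ->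
  conv pad (gact_to p p (smx R x) psi) (gact_to H' W' (smx R x) f) =
  gact_to (conv_size p pad H') (conv_size p pad W') (smx R x) (conv pad psi f).
Proof.
move=> fx; have [s sP] := grid_mapP (fits_map (conv_size p pad) fx).
have [t tP] := grid_mapP (fits_square R x p).
apply/matrixP=> i j; rewrite (gact_to_map _ (i, j) sP) !mxE.
rewrite !pair_bigA /= [RHS](reindex t); last by apply: onW_bij; case: tP.
apply: eq_bigr => q _; rewrite (gact_to_map _ _ tP); congr (_ *m _).
rewrite at_point_gact_to // mulmxBr.
by case: tP sP => _ -> [_ /(_ (i, j)) ->].
Qed.

Lemma patch_embed_gact (R : realType) (n : nat) (refl : bool) (hn : order_ok n)
    p pad s c0 c (psi : 'M['M[R]_(c0, c)]_(p, p)) H W H' W'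
    (f : 'M['rV[R]_c0]_(H, W)) (g B : symgrp R n refl) :
  fits (ssval g) H W H' W' ->
  patch_embed n refl pad s psi (gact_to H' W' (ssval g) f) B =
  gact_to _ _ (ssval g) (patch_embed n refl pad s psi f (sym_ldiv g B)).
Proof.
have [x _ Ex] := sym_code hn g; have [y _ Ey] := sym_code hn B.
move=> fx; rewrite !ffunE ssval_ldiv // Ex Ey in fx *.
(* Writing B = g (g^-1 B) exposes a kernel moved by the same g as the image. *)
have -> : gact_to p p (smx R y) psi =
    gact_to p p (smx R x) (gact_to p p (invmx (smx R x) *m smx R y) psi).
  have [z Ez] : exists z, invmx (smx R x) *m smx R y = smx R z.
    by rewrite invmx_smx smxM; eexists.
  rewrite Ez gact_toM; last exact: fits_square.
  by rewrite -Ez mulKVmx ?smx_unit.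
rewrite conv_gact //.
by apply: (sampled_gact (fun a b => @down _ s a b)); apply: fits_map.
Qed.

(** * Layers acting on tokens *)

Section Attention.
Context (R : realType) (n : nat) (refl : bool) (h w d : nat).
Context (Q K : feature_map R n refl d h w) (rpe : option ('cV[R]_2 -> R)).

Definition bias (p q : 'I_h * 'I_w) : R :=
  if rpe is Some f then
    let pq := canon_pair (grid_pos R h w p.1 p.2) (grid_pos R h w q.1 q.2) in
    f (pq.2 - pq.1)
  else 0.

(** The attention logits indexed by grid positions, which a symmetry permutes, instead of by their
    ranks. *)
Definition score (p q : 'I_h * 'I_w) : R :=
  (Num.sqrt (d * #|symgrp R n refl|)%:R)^-1 *
    (\sum_(u : 'I_d * symgrp R n refl) Q u.2 p.1 p.2 0 u.1 * K u.2 q.1 q.2 0 u.1)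
  + bias p q.

Lemma scoreE (p q : 'I_h * 'I_w) :
  ((Num.sqrt (d * #|symgrp R n refl|)%:R)^-1 *:
     (flatten_map Q *m (flatten_map K)^T) + rel_bias rpe h w)
    (enum_rank p) (enum_rank q) = score p q.
Proof.
rewrite !mxE /score; congr (_ * _ + _).
  rewrite (reindex enum_rank) /=; last exact/onW_bij/enum_rank_bij.
  by apply: eq_bigr => u _; rewrite !mxE !enum_rankK.
by rewrite /rel_bias /bias; case: rpe => [f|]; rewrite !mxE ?enum_rankK.
Qed.

End Attention.

Lemma head_evalE (R : realType) n refl c d (a : attn_head R n refl c d) h w
    (z : feature_map R n refl c h w) B (p : 'I_h * 'I_w) l :
  let s := score (equi_linear (Wq a) z) (equi_linear (Wk a) z) (head_rpe a) in
  head_eval a z B p.1 p.2 0 l =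
  \sum_q expR (s p q) / (\sum_r expR (s p r)) *
         equi_linear (Wv a) z B q.1 q.2 0 l.
Proof.
rewrite /head_eval ffunE mxE mxE -surjective_pairing mxE.
rewrite (reindex enum_rank) /=; last exact/onW_bij/enum_rank_bij.
apply: eq_bigr => q _; rewrite mxE scoreE [flatten_map _ _ _]mxE !enum_rankK.
congr (_ / _ * _).
rewrite (reindex enum_rank) /=; last exact/onW_bij/enum_rank_bij.
by apply: eq_bigr => r _; rewrite scoreE.
Qed.

Section Tokens.
Context (R : realType) (n : nat) (refl : bool) (hn : order_ok n).

Local Notation S := (symgrp R n refl).

Context (g : S) (h w h' w' : nat).
Context (s : 'I_h' * 'I_w' -> 'I_h * 'I_w) (sP : grid_map (ssval g) s).

(** This says z' = pi_g z entrywise. As a relation it leaves the two grid sizes independent, and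
    each token layer is shown to preserve it. *)
Definition moved c (z : feature_map R n refl c h w)
    (z' : feature_map R n refl c h' w') :=
  forall B p, z' B p.1 p.2 = z (sym_ldiv g B) (s p).1 (s p).2.

Lemma moved_add c (y z : feature_map R n refl c h w) y' z' :
  moved y y' -> moved z z' -> moved (y + z) (y' + z').
Proof. by move=> my mz B p; rewrite !ffunE !mxE my mz. Qed.

(** Reindexing by k |-> g^-1 k leaves the weights unchanged, as (g^-1 B)^-1 (g^-1 k) = B^-1 k. *)
Lemma moved_linear c c' (Wt : S -> 'M[R]_(c, c')) z z' :
  moved z z' -> moved (equi_linear Wt z) (equi_linear Wt z').
Proof.
move=> mz B p; rewrite !ffunE !mxE [RHS](reindex (sym_ldiv g)) /=; last first.
  exact/onW_bij/ldiv_bij.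
by apply: eq_bigr => k _; rewrite mz ldiv_ldiv.
Qed.

Lemma moved_ape c (ape : option ('cV[R]_2 -> 'rV[R]_c)) z z' :
  moved z z' -> moved (add_ape ape z) (add_ape ape z').
Proof.
case: ape => [e|//] mz B p; rewrite !ffunE !mxE mz.
by case: sP => _ ->; rewrite canon_sym.
Qed.

(** The dot product sums over the whole group index, so a common shift of it in queries and keys has
    no effect; the bias is constant on orbits of pairs. *)
Lemma score_moved d (Q K : feature_map R n refl d h w) Q' K' rpe p q :
  moved Q Q' -> moved K K' -> score Q' K' rpe p q = score Q K rpe (s p) (s q).
Proof.
move=> mQ mK; congr (_ * _ + _).
  rewrite [RHS](reindex (fun u => (u.1, sym_ldiv g u.2))) /=.
    by apply: eq_bigr => u _; rewrite mQ mK.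
  have [k kK Kk] := ldiv_bij hn g; apply: onW_bij.
  by exists (fun u => (u.1, k u.2)) => -[l B] /=; rewrite ?kK ?Kk.
rewrite /bias; case: rpe => // f; case: sP => _ posE.
by have [x _ Ex] := sym_code hn g; rewrite !posE Ex canon_pair_smx.
Qed.

(** The softmax denominator and the weighted sum both range over all tokens, which [s] permutes. *)
Lemma moved_head c d (a : attn_head R n refl c d) z z' :
  moved z z' -> moved (head_eval a z) (head_eval a z').
Proof.
move=> mz B p; apply/rowP=> l; rewrite !head_evalE.
have s_bij : bijective s by case: sP.
rewrite [RHS](reindex s) /=; last exact: onW_bij.
apply: eq_bigr => q _; rewrite (moved_linear (Wv a) mz).
have sE := score_moved (head_rpe a) _ _ (moved_linear (Wq a) mz)
  (moved_linear (Wk a) mz).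
rewrite sE; congr (_ / _ * _).
by rewrite [RHS](reindex s) /=; [apply: eq_bigr => r _; rewrite sE | apply: onW_bij].
Qed.

Lemma moved_attention c (a : attention R n refl c) z z' :
  moved z z' -> moved (attention_eval a z) (attention_eval a z').
Proof.
move=> mz; case: a => [a|hs] /=; first exact: moved_head.
elim: hs => [|a hs IHs]; first by move=> B p; rewrite !big_nil !ffunE !mxE.
by rewrite !big_cons; apply: moved_add => //; apply/moved_linear/moved_head.
Qed.

(** Gives the invariance of the mean and variance of a token. *)
Lemma moved_sum c (F : 'rV[R]_c -> R) z z' p : moved z z' ->
  \sum_B F (z' B p.1 p.2) = \sum_B F (z B (s p).1 (s p).2).
Proof.
move=> mz; rewrite [RHS](reindex (sym_ldiv g)) /=; last exact/onW_bij/ldiv_bij.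
by apply: eq_bigr => B _; rewrite mz.
Qed.

Lemma moved_layer_norm c (ln : layer_norm R c) z z' :
  moved z z' -> moved (layer_norm_eval ln z) (layer_norm_eval ln z').
Proof.
move=> mz B p; apply/rowP=> l; rewrite !ffunE !mxE mz.
have /= -> := moved_sum (fun v => \sum_l v 0 l) p mz.
(* The means now agree, so a single [m] enters both variances. *)
set m := _ / (c * #|S|)%:R.
by have /= -> := moved_sum (fun v => \sum_l (v 0 l - m) ^+ 2) p mz.
Qed.

Lemma moved_mlp c c' (m : mlp R n refl c c') z z' :
  moved z z' -> moved (mlp_eval m z) (mlp_eval m z').
Proof.
elim: m z z' => //= [c1 c2 c3 Wt m IHm|c1 c2 sigma m IHm] z z' mz; apply: IHm.
  exact: moved_linear.
by move=> B p; rewrite !ffunE !mxE mz.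
Qed.

Lemma moved_block c (b : block R n refl c) z z' :
  moved z z' -> moved (block_eval b z) (block_eval b z').
Proof.
move=> mz; have my := moved_add (moved_attention (block_sa b)
  (moved_layer_norm (block_ln1 b) mz)) mz.
exact: moved_add (moved_mlp _ (moved_layer_norm _ my)) my.
Qed.

End Tokens.

(** * Equivariance of the network *)

Section Network.
Context (R : realType) (n : nat) (refl : bool) (hn : order_ok n).

Local Notation S := (symgrp R n refl).

Context (g : S).

Lemma fits_sym h w :
  fits (ssval g) h w (gact_h (ssval g) h w) (gact_w (ssval g) h w).
Proof. by []. Qed.

Lemma feature_actE c h w h' w' (z : feature_map R n refl c h w)
    (z' : feature_map R n refl c h' w') :
  fits (ssval g) h w h' w' ->
  (forall B, z' B = gact_to h' w' (ssval g) (z (sym_ldiv g B))) ->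
  Feature z' = feature_act g (Feature z).
Proof.
case=> Eh Ew; subst h' w' => zE.
by congr Feature; apply/ffunP=> B; rewrite ffunE zE.
Qed.

(** Passes from the relation [moved] to the action; [F] is given for all grid sizes, since acting
    may exchange the sides. *)
Lemma feature_act_token c c'
    (F : forall h w, feature_map R n refl c h w -> feature_map R n refl c' h w) :
  (forall h w h' w' (s : 'I_h' * 'I_w' -> 'I_h * 'I_w), grid_map (ssval g) s ->
    forall z z', moved g s z z' -> moved g s (F _ _ z) (F _ _ z')) ->
  forall z : feature R n refl c,
  Feature (F _ _ (feature_val (feature_act g z))) =
  feature_act g (Feature (F _ _ (feature_val z))).
Proof.
move=> Fmoved [h w z]; apply: feature_actE (fits_sym h w) _ => B /=.
have [x _ Ex] := sym_code hn g.
have [s sP] : exists s : 'I_(gact_h (ssval g) h w) * 'I_(gact_w (ssval g) h w) ->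
    'I_h * 'I_w, grid_map (ssval g) s.
  by rewrite Ex; apply: grid_mapP; rewrite -Ex.
apply/matrixP=> i j; rewrite (gact_to_map _ (i, j) sP).
apply: (Fmoved _ _ _ _ s sP _ _ _ B (i, j)) => {}B p.
by rewrite ffunE (gact_to_map _ _ sP).
Qed.

Lemma feature_act_sampled (phi : nat -> nat) c c'
    (F : forall a b, 'M['rV[R]_c]_(a, b) -> 'M['rV[R]_c']_(phi a, phi b))
    (z : feature R n refl c) :
  Feature [ffun B : S => sampled F (ssval B) (feature_val (feature_act g z) B)] =
  feature_act g (Feature [ffun B : S => sampled F (ssval B) (feature_val z B)]).
Proof.
case: z => h w z; have [x _ Ex] := sym_code hn g.
have fx := fits_sym h w; rewrite {1}Ex in fx.
apply: feature_actE => [|B]; first by rewrite Ex; apply: (fits_map phi fx).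
have [y _ Ey] := sym_code hn B.
have := sampled_gact F y (z (sym_ldiv g B)) fx.
by rewrite -Ex -Ey -ssval_ldiv // !ffunE.
Qed.

Lemma inserts_act c c' (l : inserts R n refl c c') z :
  inserts_eval l (feature_act g z) = feature_act g (inserts_eval l z).
Proof.
elim: l z => //= [c1 c2 c3 Wt l IHl|k c1 c2 _ l IHl|r c1 c2 _ l IHl] z;
  rewrite -IHl; congr inserts_eval.
- by apply: feature_act_token => *; apply: moved_linear.
- exact: (feature_act_sampled (fun a b => @down _ k a b)).
- exact: (feature_act_sampled (fun a b => @pixel_shuffle R r c1 a b)).
Qed.

Lemma trunk_act L c c' (t : trunk R n refl L c c') z :
  trunk_eval t (feature_act g z) = feature_act g (trunk_eval t z).
Proof.
elim: t z => //= {L}L c1 c2 c3 b l t IHt z.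
rewrite -IHt -inserts_act; congr (trunk_eval _ (inserts_eval _ _)).
apply: (feature_act_token (F := fun h w z => block_eval b z)) => h w h' w' s sP y y'.
exact: moved_block.
Qed.

End Network.

Theorem theorem1 (R : realType) (n : nat) (refl : bool)
    (hn : n = 1%N \/ n = 2%N \/ n = 4%N)
    (c0 c L : nat) (Phi : vit R n refl c0 c L)
    (H W : nat) (x : 'M['rV[R]_c0]_(H, W)) (g : symgrp R n refl) :
  vit_eval Phi (gact (ssval g) x) = feature_act g (vit_eval Phi x).
Proof.
rewrite /vit_eval -(trunk_act hn); congr (trunk_eval _ _).
case: Phi => d p pad s /= _ psi ape _.
have [y _ Ey] := sym_code hn g.
pose embed h w (f : 'M['rV[R]_c0]_(h, w)) :=
  Feature (patch_embed n refl pad s psi f).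
(* Reading the sizes off the feature lets [embedE], whose sides have different size expressions, be
   applied under [add]. *)
pose add z :=
  Feature (@add_ape R n refl d ape (feature_h z) (feature_w z) (feature_val z)).
have addE z : add (feature_act g z) = feature_act g (add z).
  apply: (feature_act_token hn (F := fun h w z => add_ape ape z)).
  by move=> *; apply: moved_ape.
suff embedE : embed _ _ (gact (ssval g) x) = feature_act g (embed _ _ x).
  exact: etrans (congr1 add embedE) (addE _).
apply: feature_actE => [|B]; last exact: patch_embed_gact (fits_sym g H W).
have fy := fits_sym g H W; rewrite Ey in fy *.
exact: (fits_map (fun a => down_size s (conv_size p pad a)) fy).
Qed.
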